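(* Let $r=r(n)$, $s=s(n)$ satisfy $n\gg r(n)\gg s(n)$, and let $p=p(n)=\omega\left(\frac{1}{\sqrt{\binom{n-r}{r-s}\binom{r}{s}}}\right)$. Then almost surely $$q^*(G_p(n,r,s))\to 0,\quad n\to\infty.$$
   Context: For integers $n,r,s$, the Johnson graph $G(n,r,s)$ has as vertices all vectors $v\in\{0,1\}^n$ with exactly $r$ ones; two vertices are joined by an edge if and only if their inner product equals $s$. For $p\in[0,1]$, $G_p(n,r,s)$ is the random graph obtained from $G(n,r,s)$ by removing every edge with probability $1-p$ independently of all other edges. The random graphs of the sequence are regarded as defined on a common probability space. Modularity: for a graph $G$ with $e(G)$ edges and a partition $\mathcal{A}$ of its vertex set, $q(\mathcal{A})=\sum_{A\in\mathcal{A}}\frac{e(A)}{e(G)}-\sum_{A\in\mathcal{A}}\frac{(\sum_{v\in A}\deg(v))^2}{4e(G)^2}$, where $e(A)$ is the number of edges of $G$ with both endpoints in $A$. The modularity of $G$ is $q^*(G)=\max_{\mathcal{A}}q(\mathcal{A})$, over all partitions of the vertex set. $f\gg g$ and $f=\omega(g)$ both mean $f(n)/g(n)\to\infty$ as $n\to\infty$. *)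

(* Defs.v *)
From HB Require Import structures.
From mathcomp Require Import all_boot all_order all_algebra.
From mathcomp Require Import all_classical all_reals all_analysis.

Set Implicit Arguments.
Unset Strict Implicit.
Unset Printing Implicit Defensive.

Import Order.TTheory GRing.Theory Num.Theory.
Import numFieldNormedType.Exports.

Local Open Scope classical_set_scope.
Local Open Scope ring_scope.

(* A simple graph on the finite vertex type V is represented by its set of
   edges, an edge being the two-element set of its endpoints. *)
Definition graph (V : finType) := {set {set V}}.

Section Johnson.
Variables n r s : nat.

Definition johnson_vertex := {v : {ffun 'I_n -> bool} | (\sum_i v i == r)%N}.

Definition inner_product (u v : {ffun 'I_n -> bool}) : nat :=
  (\sum_i u i * v i)%N.

(* The condition u != v only matters for r = s, where it excludes loops. *)
Definition johnson_adj (u v : johnson_vertex) : bool :=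
  (u != v) && (inner_product (val u) (val v) == s).

Definition johnson_graph : graph johnson_vertex :=
  [set e : {set johnson_vertex} |
    [exists u, exists v, johnson_adj u v && (e == [set u; v]%SET)]]%SET.

End Johnson.

Section Modularity.
Variables (R : realType) (V : finType) (G : graph V).

Definition edges_in (A : {set V}) : nat := #|[set e in G | e \subset A]%SET|.

Definition degree (v : V) : nat := #|[set e in G | v \in e]%SET|.

(* If G has no edge, all quotients below are 0, so the modularity is 0. *)
Definition partition_modularity (Q : {set {set V}}) : R :=
  \sum_(A in Q) (edges_in A)%:R / #|G|%:R
  - \sum_(A in Q) ((\sum_(v in A) degree v)%N)%:R ^+ 2 / (4 * #|G|%:R ^+ 2).

Definition singletons : {set {set V}} := [set [set v]%SET | v : V]%SET.

(* The default value of the iterated maximum is attained at a partition, so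
   that this is the maximum of partition_modularity over all partitions. *)
Definition modularity : R :=
  \big[Num.max/partition_modularity singletons]_(Q : {set {set V}}
      | finset.partition Q [set: V]%SET) partition_modularity Q.

Lemma singletons_partition : finset.partition singletons [set: V]%SET.
Proof.
apply/and3P; split.
- apply/eqP/setP => v; rewrite finset.inE; apply/finset.bigcupP.
  by exists [set v]%SET; rewrite ?finset.set11// imset_f.
- apply/finset.trivIsetP => _ _ /imsetP[u _ ->] /imsetP[v _ ->] uv.
  by rewrite disjoints1 finset.in_set1; apply: contraNneq uv => ->.
- by apply/imsetP => -[v _ /setP/(_ v)]; rewrite !finset.inE eqxx.
Qed.

End Modularity.

Section RandomSubgraph.
Context (d : measure_display) (T : measurableType d) (R : realType).
Variable P : probability T R.

Definition mutually_independent (I : finType) (D : {set I}) (X : I -> set T) :=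
  forall F : {set I}, F \subset D ->
    P (\bigcap_(i in [set` F]) X i) = (\prod_(i in F) P (X i))%E.

(* Gp keeps every edge of G with probability p, independently of the others *)
Definition edge_percolation (V : finType) (G : graph V) (p : R)
    (Gp : T -> graph V) :=
  let kept e := [set w | e \in Gp w] in
  [/\ forall w, Gp w \subset G,
      forall e, e \in G -> measurable (kept e),
      forall e, e \in G -> P (kept e) = p%:E
    & mutually_independent G kept].

End RandomSubgraph.

(* f n / g n tends to +oo. The quotient is taken in the extended reals, where
   x / 0 = +oo for x > 0 and 0 / 0 = 0, so that s = 0 is allowed in r >> s. *)
Definition much_greater (R : realType) (f g : nat -> R) :=
  (fun n => (f n)%:E / (g n)%:E)%E @ \oo --> +oo%E.

(* Main.v *)
(* Write N = C(n,r) for the number of vertices and D = C(n-r,r-s) C(r,s) for the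
   degree of the Johnson graph.

   Spectral gap.  Couple the neighbourhood of u with that of its image under a
   transposition (i j), applying (i j) to the neighbours.  A neighbour moves only
   if it contains exactly one of i and j, so the adjacency operator multiplies the
   Lipschitz constant along transpositions by at most D kappa, where
   kappa = s/r + (r-s)/(n-r) tends to 0.  Hence <f, A f> <= D kappa <f, f> for
   every f of mean 0, and every set B of vertices spans at most
   (D/N) |B|^2 / 2 + D kappa |B| / 2 edges.

   Concentration.  The law of the number of kept edges in a fixed set has a Chernoff
   bound.  A union bound over the at most N^N partitions and over the N vertices
   shows that, but for an event of probability O(n^-2), the kept edges inside the
   parts of every partition and the degrees are essentially what they should be.
   This needs p D >> ln N, which holds since p D >> sqrt D and N <= D^4.  Then the
   modularity is at most 10 eps, and Borel-Cantelli concludes. *)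

Require Import Defs.
From HB Require Import structures.
From mathcomp Require Import all_boot all_order all_algebra all_fingroup.
From mathcomp Require Import all_classical all_reals all_analysis.
From mathcomp Require Import zify ring lra.

Set Implicit Arguments.
Unset Strict Implicit.
Unset Printing Implicit Defensive.

Import Order.TTheory GRing.Theory Num.Theory.
Import numFieldNormedType.Exports.

(** * Binomial coefficients *)

(** Both sides count the ordered pairs of disjoint subsets of sizes [a] and [b] of an [m]-set. *)
Lemma bin_addn_mul m a b : 'C(m, a + b) * 'C(a + b, a) = 'C(m, a) * 'C(m - a, b).
Proof.
have [h|h] := leqP (a + b) m; last first.
  rewrite (bin_small h); have [am|am] := leqP a m; last by rewrite (bin_small am).
  by rewrite (bin_small (_ : m - a < b)) ?muln0//; lia.
have h1 := bin_fact h.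
have h2 := bin_fact (leq_addr b a).
have h3 := bin_fact (_ : a <= m).
have h4 := bin_fact (_ : b <= m - a).
rewrite addKn in h2; rewrite subnDA in h1.
have {}h3 := h3 ltac:(lia); have {}h4 := h4 ltac:(lia).
have p0 : 0 < a`! * (b`! * (m - a - b)`!) by rewrite !muln_gt0 !fact_gt0.
apply/eqP; rewrite -(eqn_pmul2r p0); apply/eqP; transitivity m`!.
  by rewrite -h1 -h2 -!mulnA; congr (_ * _); rewrite !mulnA; congr (_ * _).
by rewrite -h3 -h4; lia.
Qed.

Lemma leq_binD m a b : 'C(m, a + b) <= 'C(m, a) * 'C(m, b).
Proof.
apply: (@leq_trans ('C(m, a + b) * 'C(a + b, a))).
  by rewrite leq_pmulr// bin_gt0 leq_addr.
by rewrite bin_addn_mul leq_mul2l leq_bin2l ?orbT// leq_subr.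
Qed.

(** Raising both arguments by one multiplies the binomial by [(m + 1) / (k + 1)], which is at least
    2 here. *)
Lemma leq_exp2_bin m k : 2 * k <= m -> 2 ^ k <= 'C(m, k).
Proof.
elim: k m => [|k IH] [|m]//; rewrite ?bin0// => h.
have := IH m _; have := mul_bin_diag m.+1 k; rewrite expnS /= => e {}IH.
have {}IH := IH ltac:(lia).
have : k.+1 * (2 * 'C(m, k)) <= k.+1 * 'C(m.+1, k.+1) by nia.
by rewrite leq_pmul2l//; lia.
Qed.

(** By [bin_addn_mul], ['C(m, l) * 'C(l, k) = 'C(m, k) * 'C(m - k, l - k)], and the last factor is
    at least ['C(l, k)] because [l <= m - k]. *)
Lemma leq_bin_half m k l : k <= l -> k + l <= m -> 'C(m, k) <= 'C(m, l).
Proof.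
move=> kl klm; have := bin_addn_mul m k (l - k); rewrite subnKC// => e.
have : 'C(l, k) <= 'C(m - k, l - k).
  by rewrite -bin_sub// leq_bin2l//; lia.
have : 0 < 'C(l, k) by rewrite bin_gt0.
move=> h1 h2; have : 'C(m, k) * 'C(l, k) <= 'C(m, l) * 'C(l, k) by nia.
by rewrite leq_pmul2r.
Qed.

(** This is what bounds ln N by a multiple of sqrt D. With X = ['C(n - r, r - s)], Vandermonde gives
    N <= 2^r ['C(n - r, r)], and each of these two factors is at most X^2. *)
Lemma bin_leq_johnson_degree n r s : 4 * r <= n -> 2 * s <= r ->
  'C(n, r) <= ('C(n - r, r - s) * 'C(r, s)) ^ 4.
Proof.
move=> rn sr.
have cs : 0 < 'C(r, s) by rewrite bin_gt0; lia.
apply: (@leq_trans ('C(n - r, r - s) ^ 4)); last first.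
  by rewrite leq_exp2r// leq_pmulr.
have e1 : 'C(n, r) <= 2 ^ r * 'C(n - r, r).
  have := binomial.Vandermonde r (n - r) r; rewrite subnKC; last lia.
  move=> <-.
  rewrite (_ : 2 ^ r = \sum_(j < r.+1) 'C(r, j)).
    rewrite big_distrl; apply: leq_sum => j _ /=.
    by rewrite leq_mul2l leq_bin_half ?orbT//; lia.
  have := expnDn 1 1 r; rewrite addn1 => ->.
  by apply: eq_bigr => j _; rewrite !exp1n !muln1.
have e2 : 'C(n - r, r) <= 'C(n - r, r - s) * 'C(n - r, s).
  by have := leq_binD (n - r) (r - s) s; rewrite subnK//; lia.
have e3 : 'C(n - r, s) <= 'C(n - r, r - s) by apply: leq_bin_half; lia.
have e4 : 2 ^ r <= 'C(n - r, r - s) ^ 2.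
  apply: (@leq_trans ((2 ^ (r - s)) ^ 2)); first by rewrite -expnM leq_exp2l//; lia.
  by rewrite leq_exp2r// leq_exp2_bin//; lia.
apply: leq_trans e1 _; rewrite (expnD _ 2 2) leq_mul//.
by apply: leq_trans e2 _; rewrite -mulnn leq_mul.
Qed.

(** Gives N >= n, so that failure probabilities of order N^-2 are summable over n. *)
Lemma leq_bin_interior n r : 0 < r < n -> n <= 'C(n, r).
Proof.
elim: n r => [|n IH] [|r]// h; rewrite binS.
have [rn|rn] := ltnP r.+1 n.
  have := IH r.+1 rn; have : 0 < 'C(n, r) by rewrite bin_gt0; lia.
  lia.
have -> : n = r.+1 by lia.
by rewrite binn binSn add1n.
Qed.

Local Open Scope classical_set_scope.
Local Open Scope ring_scope.

(** * Contractions *)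

Section Contraction.
Variables (R : realType) (V : finType) (A : V -> V -> R) (E : V -> V -> Prop).
Variables (q C D : R).

(** Variation is measured along [E], later the moves by one transposition, and not along the pairs
    joined by the kernel [A]. *)
Definition lipschitz_along (l : R) (f : V -> R) :=
  forall u v, E u v -> `|f u - f v| <= l.

Definition kernel_op (f : V -> R) (u : V) : R := \sum_v A u v * f v.

Hypothesis A_sym : forall u v, A u v = A v u.
Hypothesis A_row : forall u, \sum_v A u v = D.
Hypothesis q_ge0 : 0 <= q.
Hypothesis contr : forall l f, 0 <= l ->
  lipschitz_along l f -> lipschitz_along (q * l) (kernel_op f).
Hypothesis diam : forall l f, 0 <= l ->
  lipschitz_along l f -> forall u v, `|f u - f v| <= C * l.

Let dot (f g : V -> R) := \sum_u f u * g u.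

Let dotK f g : dot f (kernel_op g) = dot (kernel_op f) g.
Proof.
rewrite /dot /kernel_op.
under eq_bigr do rewrite big_distrr.
rewrite exchange_big; apply: eq_bigr => v _ /=.
by rewrite big_distrl; apply: eq_bigr => u _ /=; rewrite A_sym; ring.
Qed.

Let dot_ge0 f : 0 <= dot f f.
Proof. by apply: sumr_ge0 => u _; rewrite -expr2 sqr_ge0. Qed.

Let cauchy_schwarz f g : dot f g ^+ 2 <= dot f f * dot g g.
Proof.
have h (t : R) : 0 <= dot g g * t ^+ 2 - 2 * dot f g * t + dot f f.
  rewrite /dot mulr_suml mulr_sumr mulr_suml -sumrB -big_split.
  apply: sumr_ge0 => u _; rewrite /=.
  have -> : g u * g u * t ^+ 2 - 2 * (f u * g u) * t + f u * f u
    = (g u * t - f u) ^+ 2 by ring.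
  exact: sqr_ge0.
have [g0|g0] := eqVneq (dot g g) 0.
  have g0' u : g u = 0.
    apply/eqP; rewrite -sqrf_eq0 expr2; apply/eqP; move: u (erefl true).
    by apply: psumr_eq0P => // u _; rewrite -expr2 sqr_ge0.
  rewrite g0 mulr0 /dot big1 ?expr0n// => u _; by rewrite g0' mulr0.
have gp : 0 < dot g g by rewrite lt_neqAle eq_sym g0 dot_ge0.
have := h (dot f g / dot g g).
have -> : dot g g * (dot f g / dot g g) ^+ 2 - 2 * dot f g * (dot f g / dot g g)
   + dot f f = (dot f f * dot g g - dot f g ^+ 2) / dot g g by field.
by rewrite pmulr_lge0 ?invr_gt0// subr_ge0.
Qed.

Let iterK k f g : dot f (iter k kernel_op g) = dot (iter k kernel_op f) g.
Proof. by elim: k f => //= k IH f; rewrite dotK IH -iterS -iterSr. Qed.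

Let sum_K f : \sum_u kernel_op f u = D * \sum_u f u.
Proof.
rewrite /kernel_op exchange_big mulr_sumr; apply: eq_bigr => v _ /=.
by rewrite -mulr_suml; congr (_ * _); rewrite -(A_row v); apply: eq_bigr.
Qed.

(** For mean 0, |V| f(u) is the sum over v of f(u) - f(v), so the bound on differences passes to the
    values. *)
Let mean0_bound l f : 0 <= l -> lipschitz_along l f -> \sum_u f u = 0 ->
  forall u, `|f u| <= C * l.
Proof.
move=> l0 fl f0 u.
have N0 : (0 : R) < #|V|%:R by rewrite ltr0n; apply/card_gt0P; exists u.
rewrite -(ler_pM2l N0) -{1}(normr_nat R #|V|) -normrM.
have -> : #|V|%:R * f u = \sum_v (f u - f v).
  by rewrite sumrB f0 subr0 sumr_const -[RHS]mulr_natl.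
apply: le_trans (ler_norm_sum _ _ _) _.
apply: (@le_trans _ _ (\sum_(v : V) C * l)); last by rewrite sumr_const -[leLHS]mulr_natl.
by apply: ler_sum => v _; exact: diam.
Qed.

(* Power iteration: by Cauchy-Schwarz, the 2^k-th power of the Rayleigh quotient x
   of f is at most the quotient of K^(2^k) at f.  The contraction makes the latter
   O(q^(2^k)), so x cannot exceed q. *)
Lemma contraction_quadratic_form f :
  \sum_u f u = 0 -> \sum_u f u * kernel_op f u <= q * \sum_u f u ^+ 2.
Proof.
move=> f0; have -> : \sum_u f u ^+ 2 = dot f f.
  by apply: eq_bigr => u _; rewrite expr2.
rewrite -/(dot f (kernel_op f)).
have [b0|b0] := eqVneq (dot f f) 0.
  have := cauchy_schwarz f (kernel_op f); rewrite b0 mul0r mulr0 => h.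
  have : dot f (kernel_op f) ^+ 2 == 0 by rewrite eq_le h sqr_ge0.
  by rewrite sqrf_eq0 => /eqP ->.
have bp : 0 < dot f f by rewrite lt_neqAle eq_sym b0 dot_ge0.
(* A crude Lipschitz constant is enough: only the growth rate [q ^+ m] matters in the limit. *)
pose l0 := \sum_u \sum_v `|f u - f v|.
have l00 : 0 <= l0 by apply: sumr_ge0 => u _; apply: sumr_ge0.
have fl0 : lipschitz_along l0 f.
  move=> u v _; rewrite /l0 (bigD1 u)//= (bigD1 v)//= -addrA lerDl.
  by rewrite addr_ge0 ?sumr_ge0// => *; rewrite sumr_ge0.
have lipm m : lipschitz_along (q ^+ m * l0) (iter m kernel_op f).
  elim: m => [|m IH]; first by rewrite mul1r.
  by rewrite exprS -mulrA; apply: contr => //; rewrite mulr_ge0 ?exprn_ge0.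
have summ m : \sum_u iter m kernel_op f u = 0.
  by elim: m => // m IH; rewrite /= sum_K IH mulr0.
pose B := \sum_u `|f u| * (C * l0).
have bound m : dot f (iter m kernel_op f) <= B * q ^+ m.
  rewrite /B mulr_suml; apply: ler_sum => u _.
  apply: le_trans (ler_norm _) _; rewrite normrM -mulrA ler_wpM2l//.
  rewrite -mulrA (mulrC l0); apply: mean0_bound => //.
  by rewrite mulr_ge0 ?exprn_ge0.
pose a := dot f (kernel_op f).
rewrite leNgt; apply/negP => qba.
pose x := a / dot f f.
have qx : q < x by rewrite /x ltr_pdivlMr.
have x0 : 0 < x by apply: le_lt_trans qx.
have pw k : x ^+ (2 ^ k) <= dot f (iter (2 ^ k) kernel_op f) / dot f f.
  elim: k => [|k IH]; first by rewrite expr1.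
  rewrite expnSr exprM.
  apply: (@le_trans _ _ ((dot f (iter (2 ^ k) kernel_op f) / dot f f) ^+ 2)).
    by rewrite ler_pXn2r// nnegrE ?exprn_ge0 ?(le_trans _ IH) ?exprn_ge0 ?ltW.
  (* By symmetry, the form of the doubled power is the squared norm of [iter (2 ^ k) kernel_op f],
     which Cauchy-Schwarz bounds from below. *)
  rewrite muln2 -addnn iterD [X in _ <= X / _]iterK.
  have := cauchy_schwarz f (iter (2 ^ k) kernel_op f).
  set y := dot f (iter _ _ _); set z := dot (iter _ _ _) _ => yz.
  have -> : (y / dot f f) ^+ 2 = y ^+ 2 / dot f f / dot f f by field.
  by rewrite ler_pM2r ?invr_gt0// ler_pdivrMr// mulrC.
(* If [q] were 0, the bound on the first power would force [x <= 0]. *)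
have q0 : 0 < q.
  rewrite lt_neqAle q_ge0 andbT eq_sym; apply/eqP => q0.
  have := pw 0%N; rewrite expr1; apply/negP; rewrite -ltNge.
  by apply: le_lt_trans x0; rewrite ler_pdivrMr// mul0r (le_trans (bound _))// q0 expr1 mulr0.
pose z := x / q.
have z1 : 1 < z by rewrite /z ltr_pdivlMr// mul1r.
(* Bernoulli's inequality makes the powers of [z > 1] unbounded, which contradicts [zB] below. *)
have bern n : 1 + n%:R * (z - 1) <= z ^+ n.
  elim: n => [|n IH]; first by rewrite mul0r addr0.
  rewrite exprS; apply: (@le_trans _ _ (z * (1 + n%:R * (z - 1)))); last first.
    by rewrite ler_pM2l// (lt_trans _ z1).
  rewrite -natr1 -subr_ge0.
  have -> : z * (1 + n%:R * (z - 1)) - (1 + (n%:R + 1) * (z - 1)) =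
    n%:R * (z - 1) ^+ 2 by ring.
  by rewrite mulr_ge0 ?sqr_ge0.
have zB k : z ^+ (2 ^ k) <= B / dot f f.
  rewrite /z expr_div_n ler_pdivrMr ?exprn_gt0// mulrAC.
  by rewrite (le_trans (pw k))// ler_pM2r ?invr_gt0.
pose k := Num.bound `|B / dot f f / (z - 1)|.
have kB : B / dot f f < k%:R * (z - 1).
  rewrite -ltr_pdivrMr ?subr_gt0// /k; apply: le_lt_trans (ler_norm _) _.
  by rewrite archi_boundP.
have := zB k; apply/negP; rewrite -ltNge; apply: (lt_le_trans kB).
apply: le_trans (bern _); rewrite -[leLHS]add0r lerD// ler_pM2r ?subr_gt0//.
by rewrite ler_nat ltnW// ltn_expl.
Qed.

(** One half of the expander mixing lemma. The quadratic form bound is applied to the centred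
    indicator f = 1_B - |B|/|V|: removing the mean accounts for the term D |B|^2 / |V|, and <f, f> =
    |B| - |B|^2 / |V| <= |B|. *)
Lemma contraction_set_bound (B : {set V}) :
  \sum_(u in B) \sum_(v in B) A u v <=
    D / #|V|%:R * #|B|%:R ^+ 2 + q * #|B|%:R.
Proof.
have [->|/set0Pn[x0 _]] := eqVneq B finset.set0.
  by rewrite big_set0 cards0 expr0n/= !mulr0 addr0.
have N0 : (0 : R) < #|V|%:R by rewrite ltr0n; apply/card_gt0P; exists x0.
pose b : R := #|B|%:R / #|V|%:R.
pose f u : R := (u \in B)%:R - b.
have sB : \sum_u ((u \in B)%:R : R) = #|B|%:R.
  by rewrite -[in RHS]sum1_card natr_sum [RHS]big_mkcond; apply: eq_bigr => u _; case: ifP.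
have sf : \sum_u f u = 0.
  rewrite sumrB sB sumr_const -[X in _ - X]mulr_natl.
  by rewrite /b mulrCA divff ?gt_eqF// mulr1 subrr.
have Kf u : kernel_op f u = \sum_(v in B) A u v - D * b.
  rewrite /kernel_op /f; under eq_bigr do rewrite mulrBr.
  rewrite sumrB -mulr_suml A_row; congr (_ - _).
  by rewrite [RHS]big_mkcond; apply: eq_bigr => v _; rewrite mulr_natr; case: ifP.
have := contraction_quadratic_form sf.
have -> : \sum_u f u * kernel_op f u =
    \sum_(u in B) \sum_(v in B) A u v - D * b * #|B|%:R.
  transitivity (\sum_u ((u \in B)%:R * kernel_op f u) - b * \sum_u kernel_op f u).
    by rewrite mulr_sumr -sumrB; apply: eq_bigr => u _; rewrite mulrBl.
  rewrite sum_K sf !mulr0 subr0 -sB mulr_sumr [X in _ = X - _]big_mkcond -sumrB.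
  by apply: eq_bigr => u _; rewrite Kf mulrBr [in LHS]mulr_natl mulrC; case: ifP.
rewrite lerBlDl => h; apply: le_trans h _.
rewrite lerD//; first by rewrite /b expr2 !mulrA (mulrAC D).
rewrite ler_wpM2l//.
have -> : \sum_u f u ^+ 2 = #|B|%:R - #|B|%:R * b.
  transitivity (\sum_u ((u \in B)%:R - b * f u - b * (u \in B)%:R)).
    by apply: eq_bigr => u _; rewrite /f; case: (u \in B) => /=; ring.
  by rewrite !sumrB -!mulr_sumr sf sB mulr0 subr0 mulrC.
by rewrite gerBl mulr_ge0// divr_ge0.
Qed.
End Contraction.

(** * Johnson graphs *)

Section JohnsonGraph.
Variables n r : nat.
Implicit Types (u v : johnson_vertex n r) (i j k : 'I_n).

Definition supp v : {set 'I_n} := [set i | val v i]%SET.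

Lemma card_supp v : #|supp v| = r.
Proof.
rewrite -(eqP (valP v)) -sum1_card big_mkcond; apply: eq_bigr => i _.
by rewrite inE; case: (val v i).
Qed.

Lemma supp_inj : injective supp.
Proof.
move=> u v uv; apply/val_inj/ffunP => i.
by have := congr1 (fun A : {set 'I_n} => i \in A) uv; rewrite /= !inE.
Qed.

Lemma supp_surj (B : {set 'I_n}) : #|B| = r -> exists v, supp v = B.
Proof.
move=> Br.
have h : (\sum_i [ffun i => i \in B] i == r)%N.
  rewrite -Br -sum1_card [X in _ == X]big_mkcond; apply/eqP.
  by apply: eq_bigr => i _; rewrite ffunE; case: (_ \in _).
exists (exist _ [ffun i => i \in B] h).
by apply/setP => i; rewrite inE /= ffunE.
Qed.

Lemma inner_product_supp u v :
  inner_product (val u) (val v) = #|supp u :&: supp v|.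
Proof.
rewrite -sum1_card big_mkcond; apply: eq_bigr => i _.
by rewrite !inE; case: (val u i); case: (val v i).
Qed.

Lemma card_johnson_vertex : #|{: johnson_vertex n r}| = 'C(n, r).
Proof.
rewrite -[in RHS](card_ord n) -card_draws -(card_imset _ supp_inj).
apply: eq_card => B; rewrite inE; apply/imsetP/eqP.
  by move=> [v _ ->]; exact: card_supp.
by move=> /supp_surj[v <-]; exists v.
Qed.

Fact swap_proof i j v : (\sum_k [ffun k => val v (tperm i j k)] k == r)%N.
Proof.
rewrite -[X in _ == X](eqP (valP v)); apply/eqP.
rewrite [RHS](reindex_inj (@perm_inj _ (tperm i j))).
by apply: eq_bigr => k _; rewrite ffunE.
Qed.

(** The transposition (i j) acting on coordinates: an automorphism of the Johnson graph and the
    elementary move of the Lipschitz condition. *)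
Definition swap i j v : johnson_vertex n r :=
  exist _ [ffun k => val v (tperm i j k)] (swap_proof i j v).

Lemma in_swap i j v k : (k \in supp (swap i j v)) = (tperm i j k \in supp v).
Proof. by rewrite !inE ffunE. Qed.

Lemma swapK i j : involutive (swap i j).
Proof. by move=> v; apply/supp_inj/setP => k; rewrite !in_swap tpermK. Qed.

Lemma swap_id i j v : (i \in supp v) = (j \in supp v) -> swap i j v = v.
Proof.
by move=> ij; apply/supp_inj/setP => k; rewrite in_swap; case: tpermP => // ->.
Qed.

Lemma swapC i j v : swap i j v = swap j i v.
Proof. by apply/supp_inj/setP => k; rewrite !in_swap tpermC. Qed.

(** * Neighbourhoods and the contraction along transpositions *)

Section Adjacency.
Variable s : nat.
Local Notation adj := (@johnson_adj n r s).

Lemma johnson_adj_sym u v : adj u v = adj v u.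
Proof. by rewrite /johnson_adj !inner_product_supp finset.setIC eq_sym. Qed.

Lemma johnson_adj_swap i j u v : adj (swap i j u) (swap i j v) = adj u v.
Proof.
rewrite /johnson_adj (inv_eq (@swapK i j)) swapK; congr (_ && (_ == _)).
rewrite /inner_product [RHS](reindex_inj (@perm_inj _ (tperm i j))).
by apply: eq_bigr => k _; rewrite !ffunE.
Qed.

Definition nbr u : {set johnson_vertex n r} := [set v | adj u v]%SET.

Hypothesis sr : (s < r)%N.

Lemma johnson_adjE u v : adj u v = (#|supp u :&: supp v| == s).
Proof.
rewrite /johnson_adj inner_product_supp; case: eqVneq => // -> /=.
by rewrite finset.setIid card_supp gtn_eqF.
Qed.

(** A neighbour v of u amounts to an s-subset of the support of u, where they meet, and an (r -
    s)-subset of the complement, the rest of v. *)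
Lemma card_nbr u : #|nbr u| = ('C(n - r, r - s) * 'C(r, s))%N.
Proof.
pose X := [set B : {set 'I_n} | (B \subset supp u) && (#|B| == s)]%SET.
pose Y := [set B : {set 'I_n} | (B \subset ~: supp u) && (#|B| == (r - s)%N)]%SET.
have -> : 'C(n - r, r - s) = #|Y|.
  by rewrite cards_draws cardsCs finset.setCK card_ord card_supp.
have -> : 'C(r, s) = #|X| by rewrite cards_draws card_supp.
rewrite mulnC -cardsX -(card_imset _ supp_inj).
have split_supp (a b : {set 'I_n}) : a \subset supp u -> b \subset ~: supp u ->
    ((a :|: b) :&: supp u = a /\ (a :|: b) :\: supp u = b)%SET.
  move=> /fintype.subsetP au /fintype.subsetP bu; split; apply/setP => k;
    have := au k; have := bu k; rewrite !inE;
    case: (k \in a); case: (k \in b); case: (val u k) => //=;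
    by [move=> /(_ isT)|move=> _ /(_ isT)].
have inj : {in finset.setX X Y &, injective (fun B => B.1 :|: B.2)%SET}.
  apply: (@can_in_inj _ _ _ _ (fun B => (B :&: supp u, B :\: supp u)%SET)).
  move=> [a b]; rewrite !inE /= => /andP[/andP[au _] /andP[bu _]].
  by have [-> ->] := split_supp _ _ au bu.
rewrite -(card_in_imset inj); apply: eq_card => B; apply/imsetP/imsetP.
  move=> [v]; rewrite inE johnson_adjE => /eqP uv ->.
  exists (supp u :&: supp v, supp v :\: supp u)%SET.
    rewrite !inE /= subsetIl uv eqxx /= finset.setDE subsetIr /=.
    by rewrite -finset.setDE cardsD card_supp finset.setIC uv.
  by rewrite /= finset.setIC finset.setID.
move=> [[a b]]; rewrite !inE /= => /andP[/andP[au /eqP ca] /andP[bu /eqP cb]] ->.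
have ab : (a :&: b = finset.set0)%SET.
  apply/eqP; rewrite -finset.subset0; apply/fintype.subsetP => k; rewrite !inE => /andP[].
  by move=> /(fintype.subsetP au) ? /(fintype.subsetP bu); rewrite inE => /negP.
have : #|a :|: b| = r by rewrite cardsU ab cards0 ca cb subn0 subnKC// ltnW.
move=> /supp_surj[v vE]; exists v => //; rewrite inE johnson_adjE vE.
by rewrite finset.setIC (split_supp _ _ au bu).1 ca.
Qed.

Definition nbr_at u k : {set johnson_vertex n r} := [set v in nbr u | k \in supp v]%SET.

(** Here (i j) fixes u, so it permutes the neighbours of u and exchanges those containing i with
    those containing j. *)
Lemma card_nbr_at_swap u i j : (i \in supp u) = (j \in supp u) ->
  #|nbr_at u i| = #|nbr_at u j|.
Proof.
move=> ij; rewrite -(card_imset _ (inv_inj (@swapK i j))); apply: eq_card => v.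
have h : forall w, (swap i j w \in nbr_at u i) = (w \in nbr_at u j).
  by move=> w; rewrite !inE -{1}(swap_id ij) johnson_adj_swap ffunE tpermL.
apply/imsetP/idP => [[w wu ->]|vu].
  by rewrite -h swapK.
by exists (swap i j v); rewrite ?h ?swapK.
Qed.

(** Double counting of the pairs (j, v) with v a neighbour of u and j in both supports: every j of u
    occurs equally often by symmetry, and every v contributes s such j. *)
Lemma card_nbr_at_in u i : i \in supp u ->
  (r * #|nbr_at u i| = s * #|nbr u|)%N.
Proof.
move=> iu.
transitivity (\sum_(j in supp u) #|nbr_at u j|)%N.
  rewrite -{1}(card_supp u) -sum_nat_const; apply: eq_bigr => j ju.
  by apply: card_nbr_at_swap; rewrite iu ju.
transitivity (\sum_(j in supp u) \sum_(v in nbr u) (j \in supp v))%N.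
  apply: eq_bigr => j _; rewrite -sum1_card big_mkcond [RHS]big_mkcond.
  by apply: eq_bigr => v _; rewrite !inE; case: johnson_adj; case: (val v j).
rewrite exchange_big mulnC -sum_nat_const; apply: eq_bigr => v.
rewrite inE johnson_adjE => /eqP <-; rewrite -sum1_card big_mkcond [RHS]big_mkcond.
by apply: eq_bigr => j _; rewrite !inE; case: (val u j); case: (val v j).
Qed.

(** The same double counting over the coordinates outside u, of which every neighbour contains r -
    s. *)
Lemma card_nbr_at_notin u i : i \notin supp u ->
  ((n - r) * #|nbr_at u i| = (r - s) * #|nbr u|)%N.
Proof.
move=> iu.
transitivity (\sum_(j in ~: supp u) #|nbr_at u j|)%N.
  have -> : (n - r = #|~: supp u|)%N by rewrite cardsCs finset.setCK card_ord card_supp.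
  rewrite -sum_nat_const; apply: eq_bigr => j; rewrite inE => ju.
  by apply: card_nbr_at_swap; rewrite (negbTE iu) (negbTE ju).
transitivity (\sum_(j in ~: supp u) \sum_(v in nbr u) (j \in supp v))%N.
  apply: eq_bigr => j _; rewrite -sum1_card big_mkcond [RHS]big_mkcond.
  by apply: eq_bigr => v _; rewrite !inE; case: johnson_adj; case: (val v j).
rewrite exchange_big mulnC -sum_nat_const; apply: eq_bigr => v.
rewrite inE johnson_adjE => /eqP uv.
have -> : (r - s = #|supp v :\: supp u|)%N by rewrite cardsD card_supp finset.setIC uv.
rewrite -sum1_card big_mkcond [RHS]big_mkcond.
by apply: eq_bigr => j _; rewrite !inE; case: (val u j); case: (val v j).
Qed.

Variable R : realType.
Hypothesis rn : (r < n)%N.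
Let D : R := ('C(n - r, r - s) * 'C(r, s))%N%:R.
Let A u v : R := (adj u v)%:R.
Let E u v := exists i j, v = swap i j u.

(** The quantity kappa: the fraction of the neighbours of u that contain a given coordinate of u,
    plus the fraction that contain a given coordinate outside u. *)
Definition johnson_ratio : R := s%:R / r%:R + (r - s)%:R / (n - r)%:R.

Lemma johnson_row u : \sum_v A u v = D.
Proof.
rewrite /D -(card_nbr u) -natr_sum -sum1_card [in RHS]big_mkcond; congr _%:R.
by apply: eq_bigr => v _; rewrite inE; case: adj.
Qed.

(* The difference is a sum over the neighbours v of u of f v - f (swap i j v),
   which vanishes unless v contains exactly one of i and j. *)
Let johnson_contract_notin u i j (f : johnson_vertex n r -> R) (l : R) : 0 <= l ->
  lipschitz_along E l f -> i \in supp u -> j \notin supp u ->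
  `|kernel_op A f u - kernel_op A f (swap i j u)| <= D * johnson_ratio * l.
Proof.
move=> l0 fl iu ju.
have -> : kernel_op A f (swap i j u) = \sum_v A u v * f (swap i j v).
  rewrite /kernel_op (reindex_inj (inv_inj (@swapK i j))).
  by apply: eq_bigr => v _; rewrite /A johnson_adj_swap.
rewrite /kernel_op -sumrB; apply: le_trans (ler_norm_sum _ _ _) _.
apply: (@le_trans _ _ (\sum_(v in nbr u) ((i \in supp v)%:R + (j \in supp v)%:R) * l)).
  rewrite [leRHS]big_mkcond; apply: ler_sum => v _; rewrite inE /A.
  case: adj => /=; last by rewrite !mul0r subrr normr0.
  rewrite !mul1r; have [ij|ij] := eqVneq (i \in supp v) (j \in supp v).
    by rewrite swap_id// subrr normr0 mulr_ge0// addr_ge0.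
  have -> : (i \in supp v)%:R + (j \in supp v)%:R = 1 :> R.
    by move: ij; do 2 case: (_ \in _) => //=; rewrite ?addr0 ?add0r.
  by rewrite mul1r; apply: fl; exists i, j.
rewrite -mulr_suml ler_wpM2r// big_split /=.
have at_ k : \sum_(v in nbr u) (k \in supp v)%:R = #|nbr_at u k|%:R :> R.
  rewrite -natr_sum -sum1_card big_mkcond [in RHS]big_mkcond; congr _%:R.
  by apply: eq_bigr => v _; rewrite !inE; case: johnson_adj; case: (val v k).
rewrite !at_ /D -(card_nbr u) /johnson_ratio mulrDr.
have r0 : (0 : R) < r%:R by rewrite ltr0n (leq_ltn_trans _ sr).
have nr0 : (0 : R) < (n - r)%:R by rewrite ltr0n subn_gt0.
rewrite lerD// mulrA ler_pdivlMr// -!natrM ler_nat.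
  by rewrite mulnC (card_nbr_at_in iu) mulnC.
by rewrite mulnC (card_nbr_at_notin ju) mulnC.
Qed.

Lemma johnson_contract (l : R) (f : johnson_vertex n r -> R) : 0 <= l ->
  lipschitz_along E l f -> lipschitz_along E (D * johnson_ratio * l) (kernel_op A f).
Proof.
move=> l0 fl u _ [i [j ->]].
have [ij|] := eqVneq (i \in supp u) (j \in supp u).
  rewrite swap_id// subrr normr0.
  by rewrite !mulr_ge0// addr_ge0 ?divr_ge0.
case: (boolP (i \in supp u)); case: (boolP (j \in supp u)) => // ju iu _.
  exact: johnson_contract_notin.
by rewrite swapC; exact: johnson_contract_notin.
Qed.

(** Exchanging some i of u outside v with some j of v outside u is one move and shrinks the
    difference of the supports, so at most n moves lead from u to v. *)
Lemma johnson_diam (l : R) (f : johnson_vertex n r -> R) : 0 <= l -> lipschitz_along E l f ->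
  forall u v, `|f u - f v| <= n%:R * l.
Proof.
move=> l0 fl u v.
suff H m : forall u, (#|supp u :\: supp v| <= m)%N -> `|f u - f v| <= m%:R * l.
  apply: H; apply: leq_trans (max_card _) _; by rewrite card_ord.
elim: m => [|m IH] {}u.
  rewrite leqn0 cards_eq0 finset.setD_eq0 => uv.
  have -> : u = v by apply/supp_inj/eqP; rewrite eqEcard uv !card_supp /=.
  by rewrite subrr normr0 mul0r.
have [uv um|/set0Pn[i iuv] um] := eqVneq (supp u :\: supp v)%SET finset.set0.
  apply: le_trans (IH u _) _; first by rewrite uv cards0.
  by rewrite ler_wpM2r// ler_nat.
have [j jvu] : exists j, (j \in supp v :\: supp u)%SET.
  apply/set0Pn; rewrite -card_gt0.
  have -> : #|supp v :\: supp u| = #|supp u :\: supp v|.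
    by rewrite !cardsD !card_supp finset.setIC.
  by apply/card_gt0P; exists i.
rewrite -(subrKA (f (swap i j u))) -natr1 mulrDl mul1r addrC.
apply: le_trans (ler_normD _ _) _; rewrite lerD//; last by apply: fl; exists i, j.
apply: IH; rewrite -ltnS; apply: leq_trans um.
apply: proper_card; apply/properP; split.
  apply/fintype.subsetP => k; rewrite 2!inE in_swap => /andP[kv]; rewrite !(inE, kv)/=.
  move: iuv jvu kv; rewrite !inE.
  case: tpermP => // [->|->]; first by move=> /andP[_ ->].
  by move=> _ /andP[_ ->].
exists i => //; rewrite !inE ffunE tpermL.
by move: jvu; rewrite !inE => /andP[/negbTE -> _]; rewrite andbF.
Qed.

Lemma johnson_set_bound (B : {set johnson_vertex n r}) :
  \sum_(u in B) \sum_(v in B) A u v <=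
    D / #|{: johnson_vertex n r}|%:R * #|B|%:R ^+ 2 + D * johnson_ratio * #|B|%:R.
Proof.
apply: (@contraction_set_bound _ _ A E _ n%:R).
- by move=> u v; rewrite /A johnson_adj_sym.
- exact: johnson_row.
- by rewrite mulr_ge0// addr_ge0 ?divr_ge0.
- exact: johnson_contract.
- exact: johnson_diam.
Qed.

End Adjacency.
End JohnsonGraph.

(** * Modularity *)

Section Graphs.
Variables (V : finType).
Implicit Types (G : graph V) (B : {set V}).

Definition simple_graph G := forall e, e \in G -> #|e| = 2%N.

Lemma simple_graph_sub (G H : graph V) : H \subset G -> simple_graph G -> simple_graph H.
Proof. by move=> /fintype.subsetP HG sG e /HG/sG. Qed.

Lemma sum_degree G : simple_graph G -> (\sum_v degree G v = 2 * #|G|)%N.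
Proof.
move=> sG; transitivity (\sum_v \sum_(e in G) (v \in e))%N.
  apply: eq_bigr => v _; rewrite /degree -sum1_card big_mkcond [RHS]big_mkcond.
  by apply: eq_bigr => e _; rewrite inE; case: (e \in G); case: (v \in e).
rewrite exchange_big mulnC -sum_nat_const; apply: eq_bigr => e /sG <-.
by rewrite -sum1_card [RHS]big_mkcond; apply: eq_bigr => v _; case: (v \in e).
Qed.

(** The map sending v to {u, v} is injective. At v = u it gives a singleton, which is not an edge of
    a simple graph. *)
Lemma degreeE G u : simple_graph G -> (degree G u = \sum_v ([set u; v]%SET \in G))%N.
Proof.
move=> sG; rewrite -big_mkcond sum1dep_card.
have inj : injective (fun v => [set u; v]%SET).
  move=> v w /setP e; have := e v; have := e w; rewrite !inE !eqxx !orbT.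
  by case: (eqVneq w u) => [->|_] /=; [rewrite orbb => _ /esym/eqP|move=> /eqP].
rewrite -(card_imset _ inj); apply: eq_card => e; rewrite inE.
apply/andP/imsetP => [[eG ue]|[v]].
  have /eqP/cards2P[a [b [ab eE]]] := sG _ eG.
  have : u \in [set a; b]%SET by rewrite -eE.
  rewrite !inE => /orP[/eqP ua|/eqP ub].
    by exists b; rewrite ?inE ua -eE.
  by exists a; rewrite ?inE ub finset.setUC -eE.
by rewrite inE => vG ->; rewrite vG !inE eqxx.
Qed.

(** The handshake identity for the subgraph of the edges inside [B]. *)
Lemma sum_adjacency_in G B : simple_graph G ->
  (\sum_(u in B) \sum_(v in B) ([set u; v]%SET \in G) = 2 * edges_in G B)%N.
Proof.
move=> sG; have sub : [set e in G | e \subset B]%SET \subset G.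
  by apply/fintype.subsetP => e; rewrite inE => /andP[].
rewrite /edges_in -(sum_degree (simple_graph_sub sub sG)).
rewrite big_mkcond; apply: eq_bigr => u _.
rewrite degreeE; last exact: simple_graph_sub sub sG.
case: ifP => uB; last first.
  rewrite big1// => v _; rewrite !inE finset.subUset finset.sub1set uB /=.
  by rewrite andbF.
rewrite big_mkcond; apply: eq_bigr => v _.
rewrite !inE finset.subUset !finset.sub1set uB /=.
by case: (v \in B); rewrite ?andbT ?andbF.
Qed.

(* The edges inside the parts of a partition are encoded as the edges that are
   monochromatic for a colouring V -> V (see block_representative), because there
   are only #|V| ^ #|V| such colourings for the union bound. *)
Definition monochromatic (g : {ffun V -> V}) : {set {set V}} :=
  [set e : {set V} | [forall u in e, forall v in e, g u == g v]]%SET.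

Definition block_representative (Q : {set {set V}}) : {ffun V -> V} :=
  [ffun u => odflt u [pick x in finset.pblock Q u]].

(** An edge lies inside a part exactly when its endpoints have the same representative, and then
    that part is unique. *)
Lemma sum_edges_in_partition G (Q : {set {set V}}) : simple_graph G ->
  finset.partition Q [set: V]%SET ->
  (\sum_(B in Q) edges_in G B = #|G :&: monochromatic (block_representative Q)|)%N.
Proof.
move=> sG /and3P[/eqP cQ tQ Q0].
set g := block_representative Q.
have gin u : g u \in finset.pblock Q u.
  rewrite ffunE; case: pickP => [x //|/(_ u)].
  by rewrite mem_pblock cQ inE.
have pbl u : finset.pblock Q u \in Q by rewrite pblock_mem// cQ inE.
transitivity (\sum_(e in G) \sum_(B in Q) (e \subset B))%N.
  rewrite exchange_big; apply: eq_bigr => B _.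
  rewrite /edges_in -sum1_card big_mkcond [RHS]big_mkcond.
  by apply: eq_bigr => e _; rewrite inE; case: (e \in G); case: (e \subset B).
rewrite -sum1_card [RHS]big_mkcond [LHS]big_mkcond; apply: eq_bigr => e _.
rewrite !inE; case: ifP => //= eG; have /eqP/cards2P[a [b [ab eE]]] := sG _ eG.
have [mono|] := boolP [forall u in e, forall v in e, g u == g v].
  move: mono => /forall_inP/(_ a); rewrite eE !inE eqxx => /(_ isT) /forall_inP/(_ b).
  rewrite !inE eqxx orbT => /(_ isT) /eqP gab.
  have pab : finset.pblock Q a = finset.pblock Q b.
    have ga := gin a; have gb := gin b; rewrite gab in ga.
    by rewrite -(same_pblock tQ ga) (same_pblock tQ gb).
  rewrite (bigD1 (finset.pblock Q a))//= big1.
    by rewrite finset.subUset !finset.sub1set {2}pab !mem_pblock cQ !inE.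
  move=> B /andP[BQ Ba]; apply/eqP; rewrite eqb0; apply: contra Ba.
  rewrite finset.subUset finset.sub1set => /andP[aB _].
  by rewrite (def_pblock tQ BQ aB).
move=> h; rewrite big1// => B BQ; apply/eqP; rewrite eqb0; apply: contra h.
move=> /fintype.subsetP eB; apply/forall_inP => u /eB uB; apply/forall_inP => v /eB vB.
(* The choice made by [pick] depends on the block alone, and the default is not reached because the
   block contains [u]. *)
have := gin u; rewrite /g /block_representative !ffunE.
rewrite (def_pblock tQ BQ uB) (def_pblock tQ BQ vB).
by case: pickP => // /(_ u); rewrite uB.
Qed.
End Graphs.

(** * Deterministic modularity bound for a typical subgraph of an expander *)

Section ModularityBound.
Variables (R : realType) (V : finType) (G H : graph V).
Variables (d : nat) (p eps kappa : R).
Hypotheses (sG : simple_graph G) (HG : H \subset G).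
Hypothesis V0 : (0 < #|V|)%N.
Hypothesis d0 : (0 < d)%N.
Hypothesis degG : forall v, degree G v = d.
Hypothesis expander : forall B : {set V}, (2 * edges_in G B)%:R <=
  d%:R / #|V|%:R * #|B|%:R ^+ 2 + d%:R * kappa * #|B|%:R.
Hypotheses (p0 : 0 < p) (eps0 : 0 < eps) (eps2 : 2 * eps <= 1).
Hypotheses (kappa0 : 0 <= kappa) (kappa_eps : kappa <= eps).
Hypothesis upH : forall g : {ffun V -> V},
  #|H :&: monochromatic g|%:R <=
    p * #|G :&: monochromatic g|%:R + eps * p * #|G|%:R.
Hypothesis lowH : forall v, (1 - eps) * p * d%:R <= (degree H v)%:R.

Let sH : simple_graph H. Proof. exact: simple_graph_sub HG sG. Qed.
Let M : R := #|G|%:R.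
Let N : R := #|V|%:R.
Let h : R := #|H|%:R.

Let N0 : 0 < N. Proof. by rewrite ltr0n. Qed.
Let dR0 : 0 < d%:R :> R. Proof. by rewrite ltr0n. Qed.

Let cardG : 2 * M = N * d%:R.
Proof.
by rewrite /M -natrM -(sum_degree sG) (eq_bigr (fun=> d))// sum_nat_const natrM.
Qed.

Let M0 : 0 < M.
Proof.
have Nd : 0 < N * d%:R by exact: mulr_gt0.
by move: Nd; rewrite -cardG pmulr_rgt0.
Qed.

Let h_ge : (1 - eps) * p * M <= h.
Proof.
suff : (1 - eps) * p * (2 * M) <= 2 * h by lra.
rewrite cardG /h -natrM -(sum_degree sH) natr_sum.
apply: (@le_trans _ _ (\sum_(v : V) (1 - eps) * p * d%:R)).
  by rewrite sumr_const -[leRHS]mulr_natl -/N; nra.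
by apply: ler_sum => v _; exact: lowH.
Qed.

Let h_le : h <= (1 + eps) * p * M.
Proof.
(* For a constant colouring every edge is monochromatic, so [upH] bounds the total number of
   edges. *)
have [v0 _] := card_gt0P V0.
pose g : {ffun V -> V} := [ffun=> v0].
have mono K : K :&: monochromatic g = K.
  apply/finset.setIidPl/fintype.subsetP => e _; rewrite inE.
  by apply/forall_inP => u _; apply/forall_inP => v _; rewrite !ffunE.
by have := upH g; rewrite !mono -/M -/h; lra.
Qed.

Let h0 : 0 < h.
Proof. by apply: lt_le_trans h_ge; rewrite !mulr_gt0// subr_gt0; move: eps2 eps0; lra. Qed.

Let volume_ge (B : {set V}) :
  (1 - eps) * p * d%:R * #|B|%:R <= (\sum_(v in B) degree H v)%N%:R.
Proof.
rewrite natr_sum mulr_natr -sumr_const; apply: ler_sum => v _; exact: lowH.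
Qed.

(** With W the sum of (|B|/N)^2 and y = p M / h, the edge term is at most y (W + kappa + eps) and
    the degree term at least ((1 - eps) y)^2 W. As y is close to 1, the multiples of W nearly
    cancel. *)
Let partition_modularity_le (Q : {set {set V}}) :
  finset.partition Q [set: V]%SET -> partition_modularity R H Q <= 10 * eps.
Proof.
move=> PQ; rewrite /partition_modularity.
pose W : R := \sum_(B in Q) (#|B|%:R / N) ^+ 2.
have sQ : \sum_(B in Q) #|B|%:R = N.
  by rewrite /N -cardsT (card_partition PQ) natr_sum.
have W0 : 0 <= W by apply: sumr_ge0 => B _; exact: sqr_ge0.
have W1 : W <= 1.
  rewrite -(@divff _ N) ?gt_eqF// -{1}sQ mulr_suml; apply: ler_sum => B _.
  have b0 : 0 <= #|B|%:R / N by rewrite divr_ge0// ltW.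
  rewrite expr2 ler_piMl// ler_pdivrMr// mul1r ler_nat; exact: max_card.
have inner : \sum_(B in Q) (edges_in G B)%:R <= M * (W + kappa).
  suff : 2 * \sum_(B in Q) (edges_in G B)%:R <= 2 * M * (W + kappa) by lra.
  rewrite cardG mulr_sumr; apply: (@le_trans _ _
    (\sum_(B in Q) (d%:R / N * #|B|%:R ^+ 2 + d%:R * kappa * #|B|%:R))).
    by apply: ler_sum => B _; rewrite -natrM; exact: expander.
  rewrite big_split /= -mulr_sumr -mulr_sumr sQ mulrDr /W mulr_sumr lerD//.
    rewrite mulr_sumr; apply: ler_sum => B _; rewrite le_eqVlt; apply/orP; left.
    by apply/eqP; field; rewrite gt_eqF.
  by rewrite mulrC mulrA.
have innerH : \sum_(B in Q) (edges_in H B)%:R / h <= p * M * (W + kappa + eps) / h.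
  rewrite -mulr_suml ler_pM2r ?invr_gt0//.
  have := upH (block_representative Q).
  rewrite -(sum_edges_in_partition sG PQ) -(sum_edges_in_partition sH PQ) !natr_sum.
  move=> le1; apply: le_trans le1 _; rewrite -/M.
  by have := ler_wpM2l (ltW p0) inner; lra.
have volH : ((1 - eps) * p * M / h) ^+ 2 * W <=
    \sum_(B in Q) ((\sum_(v in B) degree H v)%N)%:R ^+ 2 / (4 * h ^+ 2).
  rewrite /W mulr_sumr; apply: ler_sum => B _.
  have -> : ((1 - eps) * p * M / h) ^+ 2 * (#|B|%:R / N) ^+ 2 =
    ((1 - eps) * p * d%:R * #|B|%:R) ^+ 2 / (4 * h ^+ 2).
    have -> : M = N * d%:R / 2 by rewrite -cardG; lra.
    by field; rewrite !gt_eqF.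
  rewrite ler_pM2r ?invr_gt0 ?mulr_gt0 ?exprn_gt0//.
  rewrite ler_pXn2r// ?nnegrE ?volume_ge// !mulr_ge0// ?ltW// ?subr_gt0; move: eps2 eps0; lra.
apply: le_trans (lerB innerH volH) _.
pose y := p * M / h.
have pM0 : 0 < p * M by rewrite mulr_gt0.
have y0 : 0 < y by rewrite divr_gt0.
have y1 : (1 - eps) * y <= 1 by rewrite /y !mulrA ler_pdivrMr// mul1r.
have y2 : 1 <= (1 + eps) * y by rewrite /y !mulrA ler_pdivlMr// mul1r.
have -> : p * M * (W + kappa + eps) / h = y * (W + kappa + eps).
  by rewrite /y; ring.
have -> : (1 - eps) * p * M / h = (1 - eps) * y by rewrite /y; ring.
have [e0 e2 k0 ke] := And4 eps0 eps2 kappa0 kappa_eps.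
(* Since eps <= 1/2, y <= 1/(1 - eps) <= 2; also y >= 1/(1 + eps) >= 1 - eps, and 1 - (1 - eps)^3 <=
   3 eps. The two remaining terms are at most 6 eps and 4 eps. *)
have yle2 : y <= 2 by nra.
have y_ge : 1 - eps <= y by nra.
have key : 1 - (1 - eps) ^+ 2 * y <= 3 * eps by nra.
have -> : y * (W + kappa + eps) - ((1 - eps) * y) ^+ 2 * W =
  y * W * (1 - (1 - eps) ^+ 2 * y) + y * (kappa + eps) by ring.
have yW0 : 0 <= y * W by rewrite mulr_ge0 ?(ltW y0).
have yW2 : y * W <= 2 by nra.
have := ler_wpM2l yW0 key; have : y * W * (3 * eps) <= 6 * eps by nra.
have : y * (kappa + eps) <= 4 * eps by nra.
lra.
Qed.

(** The lower bound comes from the partition into a single block, whose value is 1 - 1 = 0. *)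
Lemma modularity_bounds : 0 <= modularity R H <= 10 * eps.
Proof.
apply/andP; split; last first.
  apply: bigmax_le => [|Q]; last exact: partition_modularity_le.
  exact: partition_modularity_le (singletons_partition V).
have PT : finset.partition [set [set: V]]%SET [set: V]%SET.
  apply/and3P; split.
  - by rewrite /finset.cover big_set1.
  - by apply/finset.trivIsetP => A B; rewrite !inE => /eqP-> /eqP->; rewrite eqxx.
  - by rewrite finset.in_set1 eq_sym -card_gt0 cardsT.
suff : 0 <= partition_modularity R H [set [set: V]]%SET.
  by move=> q0; rewrite /modularity; apply: (bigmax_sup [set [set: V]]%SET).
rewrite /partition_modularity !big_set1.
have -> : edges_in H [set: V]%SET = #|H|.
  by apply: eq_card => e; rewrite inE finset.subsetT andbT.
have -> : (\sum_(v in [set: V]%SET) degree H v = 2 * #|H|)%N.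
  by rewrite -(sum_degree sH); apply: eq_bigl => v; rewrite inE.
by rewrite natrM -/h divff ?gt_eqF// exprMn -natrX divff ?subrr ?mulf_neq0 ?sqrf_eq0 ?gt_eqF.
Qed.
End ModularityBound.

(** * Random subgraphs *)

(** From e^x (1 - x) <= 1 and (1 - x)(1 + x + 2 x^2) = 1 + x^2 (1 - 2 x). Negative x are covered
    too, as the lower tail requires. *)
Lemma expRD1_le (R : realType) (x : R) : x <= 2^-1 ->
  expR x <= 1 + (x + 2 * x ^+ 2).
Proof.
move=> x2; have x1 : 0 < 1 - x by lra.
have e1 : expR x * (1 - x) <= 1.
  rewrite -[leRHS](expR0 R) -[in leRHS](subrr x) expRD ler_pM2l ?expR_gt0//.
  exact: expR_ge1Dx.
rewrite -(ler_pM2r x1); apply: le_trans e1 _.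
have : 0 <= x ^+ 2 * (1 - 2 * x) by rewrite mulr_ge0 ?sqr_ge0//; lra.
lra.
Qed.

Lemma sum_subsets_exp (R : comNzRingType) (I : finType) (A : {set I}) (x : R) :
  \sum_(J : {set I} | J \subset A) x ^+ #|J| = (x + 1) ^+ #|A|.
Proof.
rewrite -prodr_const big_mkcond.
transitivity (\prod_(i : I) ((if i \in A then x else 0) + 1)); last first.
  by rewrite [RHS]big_mkcond; apply: eq_bigr => i _; case: ifP; rewrite ?add0r.
rewrite bigA_distr; apply: eq_big => [J|J _]; first by rewrite inE.
rewrite -big_mkcond/=; case: ifPn => [JA|/subsetPn[i iJ iA]].
  by rewrite -prodr_const; apply: eq_bigr => i /(fintype.subsetP JA) ->.
by rewrite (bigD1 i)//= (negbTE iA) mul0r.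
Qed.

(** * Laws of random variables with finitely many values *)

Section FiniteDistribution.
Context (d : measure_display) (T : measurableType d) (R : realType).
Variables (P : probability T R) (J : finType) (X : T -> J).
Hypothesis mX : forall j, measurable [set w | X w = j].

Definition pmf (j : J) : R := fine (P [set w | X w = j]).

Lemma pmf_ge0 j : 0 <= pmf j.
Proof. by rewrite fine_ge0. Qed.

Lemma measurable_fin_event (A : {set J}) : measurable [set w | X w \in A].
Proof.
have -> : [set w | X w \in A] = \bigcup_(j in [set` A]) [set w | X w = j].
  apply/seteqP; split => w /=; first by move=> wA; exists (X w).
  by move=> [j /= jA ->].
by apply: fin_bigcup_measurable => // j _; exact: finite_finset.
Qed.

Lemma probability_fin_event (A : {set J}) :
  P [set w | X w \in A] = (\sum_(j in A) pmf j)%:E.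
Proof.
rewrite -big_enum /=.
have -> : [set w | X w \in A] = [set w | X w \in enum A].
  by apply/seteqP; split => w /=; rewrite mem_enum.
elim: (enum A) (enum_uniq A) => [_|j s IH /= /andP[js us]].
  rewrite big_nil (_ : [set _ | _] = set0) ?measure0//.
  by apply/seteqP; split.
rewrite big_cons EFinD -IH// /pmf fineK ?fin_num_measure// -measureU//.
- congr (P _); apply/seteqP; split => w /=; rewrite in_cons.
    by move=> /orP[/eqP|]; [left|right].
  by move=> [->|->]; rewrite ?eqxx ?orbT.
- have -> : [set w | X w \in s] = [set w | X w \in [set j in s]%SET].
    by apply/seteqP; split => w /=; rewrite inE.
  exact: measurable_fin_event.
- by apply/seteqP; split => // w [/= ->]; apply/negP.
Qed.

End FiniteDistribution.

(** * Concentration for edge percolation *)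

Section Percolation.
Context (d : measure_display) (T : measurableType d) (R : realType).
Variables (P : probability T R) (V : finType) (G : graph V) (p : R).
Variable Gp : T -> graph V.
Hypothesis percG : edge_percolation P G p Gp.
Hypothesis p01 : 0 <= p <= 1.

(** For [H] inside [G], the event is a finite intersection over the edges of [G] of the events that
    an edge is kept, or of their complements. *)
Lemma measurable_percolation (H : graph V) : measurable [set w | Gp w = H].
Proof.
have [subG mG _ _] := percG.
have [HG|HG] := boolP (H \subset G); last first.
  rewrite (_ : [set _ | _] = set0)//; apply/seteqP; split => // w /= wH.
  by move: HG; rewrite -wH subG.
have -> : [set w | Gp w = H] = \bigcap_(e in [set` G])
    (if e \in H then [set w | e \in Gp w] else ~` [set w | e \in Gp w]).
  apply/seteqP; split => w /=.
    by move=> wH e _ /=; case: ifP => /= eH; rewrite wH eH.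
  move=> h; apply/setP => e; have [eG|eG] := boolP (e \in G).
    by have := h e eG; case: ifP => _ /=; [|move/negP/negbTE].
  transitivity false.
    by apply/negbTE; apply: contra eG; exact/fintype.subsetP.
  by apply/esym/negbTE; apply: contra eG; exact/fintype.subsetP.
apply: fin_bigcap_measurable; first exact: finite_finset.
by move=> e /= eG; case: ifP => _; [|apply: measurableC]; exact: mG.
Qed.

Let mu := pmf P Gp.

Lemma percolation_superset (F : graph V) : F \subset G ->
  \sum_(H : graph V | F \subset H) mu H = p ^+ #|F|.
Proof.
move=> FG; have [subG mG pG indep] := percG.
apply: EFin_inj; rewrite (eq_bigl [in [set H : graph V | F \subset H]%SET]); last first.
  by move=> H; rewrite !inE.
rewrite -(probability_fin_event _ measurable_percolation).
have -> : [set w | Gp w \in [set H : graph V | F \subset H]%SET] =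
    \bigcap_(e in [set` F]) [set w | e \in Gp w].
  apply/seteqP; split => w /=; rewrite inE; first by move=> /fintype.subsetP h e /h.
  by move=> h; apply/fintype.subsetP => e eF; exact: h.
rewrite indep//; transitivity (\prod_(e in F) p%:E)%E.
  by apply: eq_bigr => e /(fintype.subsetP FG) /pG.
by rewrite prodEFin prodr_const.
Qed.

(* Expanding (x + 1) ^ #|H :&: S| over the subsets of H :&: S leaves only
   probabilities of the form P(F is kept), so the product rule suffices. *)
Lemma percolation_mgf (S : graph V) (x : R) : S \subset G ->
  \sum_(H : graph V) mu H * (x + 1) ^+ #|H :&: S| = (x * p + 1) ^+ #|S|.
Proof.
move=> SG; rewrite -sum_subsets_exp.
under eq_bigr do rewrite -sum_subsets_exp mulr_sumr.
rewrite (exchange_big_dep (fun F : graph V => F \subset S)) /=; last first.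
  by move=> H F _; rewrite finset.subsetI => /andP[].
apply: eq_bigr => F FS.
rewrite exprMn -percolation_superset; last exact: fintype.subset_trans SG.
rewrite mulr_sumr; apply: eq_big => [H|H _]; last exact: mulrC.
by rewrite finset.subsetI FS andbT.
Qed.

(** Markov's inequality for exp(h |H :&: S|), whose mean is given by [percolation_mgf] at x = e^h -
    1. Either sign of [h] is allowed, so both tails are covered. *)
Lemma percolation_chernoff (S : graph V) (h c : R) : S \subset G -> h <= 2^-1 ->
  \sum_(H : graph V | c <= h * #|H :&: S|%:R) mu H <=
    expR (p * #|S|%:R * (h + 2 * h ^+ 2) - c).
Proof.
move=> SG h2; have /andP[p0 p1] := p01.
apply: (@le_trans _ _ (\sum_(H : graph V)
    mu H * ((expR h - 1) + 1) ^+ #|H :&: S| * expR (- c))).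
  rewrite big_mkcond; apply: ler_sum => H _; rewrite subrK -expRM_natl -mulrA -expRD.
  case: ifP => hc; last by rewrite mulr_ge0 ?pmf_ge0 ?expR_ge0.
  rewrite ler_peMr ?pmf_ge0// -[leLHS]expR0 ler_expR subr_ge0.
  by rewrite mulrC.
rewrite -mulr_suml percolation_mgf// expRD ler_pM2r ?expR_gt0//.
have -> : p * #|S|%:R * (h + 2 * h ^+ 2) = #|S|%:R * (p * (h + 2 * h ^+ 2)) by ring.
rewrite expRM_natl lerXn2r ?nnegrE ?expR_ge0//.
  have -> : (expR h - 1) * p + 1 = expR h * p + (1 - p) by ring.
  by rewrite addr_ge0 ?mulr_ge0 ?expR_ge0 ?subr_ge0.
apply: le_trans (expR_ge1Dx _); rewrite addrC lerD2l mulrC ler_wpM2l//.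
by rewrite lerBlDl expRD1_le.
Qed.

Variables (eps : R) (deg : nat).
Hypothesis eps01 : 0 < eps <= 1.
Hypothesis degG : forall v, degree G v = deg.

Let star v := [set e in G | v \in e]%SET.
Let high g (H : graph V) := p * #|G :&: monochromatic g|%:R + eps * p * #|G|%:R <
  (#|H :&: (G :&: monochromatic g)|%:R : R).
Let low v (H : graph V) := (#|H :&: star v|%:R : R) < (1 - eps) * p * deg%:R.

(** Only two one-sided deviations are excluded, those that could raise the modularity: too many
    edges inside parts and too small degrees. *)
Definition typical : {set graph V} := [set H : graph V |
  [forall g, ~~ high g H] && [forall v, ~~ low v H]]%SET.

Lemma typical_monochromatic (H : graph V) g : H \subset G -> H \in typical ->
  #|H :&: monochromatic g|%:R <=
    p * #|G :&: monochromatic g|%:R + eps * p * #|G|%:R.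
Proof.
move=> HG; rewrite inE => /andP[/forallP/(_ g) + _].
by rewrite /high -leNgt finset.setIA (finset.setIidPl HG).
Qed.

Lemma typical_degree (H : graph V) v : H \subset G -> H \in typical ->
  (1 - eps) * p * deg%:R <= (degree H v)%:R.
Proof.
move=> HG; rewrite inE => /andP[_ /forallP/(_ v)]; rewrite /low -leNgt.
have -> : (H :&: star v = [set e in H | v \in e])%SET => //.
apply/setP => e; rewrite !inE; have [eH|//] := boolP (e \in H).
by rewrite (fintype.subsetP HG).
Qed.

Lemma probability_atypical : (P [set w | Gp w \notin typical] <=
  ((#|V| ^ #|V|)%N%:R * expR (- (eps ^+ 2 / 8 * p * #|G|%:R))
   + #|V|%:R * expR (- (eps ^+ 2 / 8 * p * deg%:R)))%:E)%E.
Proof.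
have /andP[p0 p1] := p01; have /andP[e0 e1] := eps01.
have -> : [set w | Gp w \notin typical] = [set w | Gp w \in (~: typical)%SET].
  by apply/seteqP; split => w /=; rewrite finset.in_setC.
rewrite (probability_fin_event _ measurable_percolation) lee_fin.
apply: (@le_trans _ _ (\sum_(g : {ffun V -> V}) \sum_(H | high g H) mu H +
   \sum_(v : V) \sum_(H | low v H) mu H)).
  under [X in _ <= X + _]eq_bigr do rewrite big_mkcond.
  under [X in _ <= _ + X]eq_bigr do rewrite big_mkcond.
  rewrite exchange_big [X in _ <= _ + X]exchange_big -big_split big_mkcond.
  apply: ler_sum => H _ /=; have m0 : 0 <= mu H by exact: pmf_ge0.
  have s1 : 0 <= \sum_(g : {ffun V -> V}) (if high g H then mu H else 0).
    by apply: sumr_ge0 => g _; case: ifP.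
  have s2 : 0 <= \sum_(v : V) (if low v H then mu H else 0).
    by apply: sumr_ge0 => g _; case: ifP.
  rewrite !inE; case: ifPn => [|_]; last exact: addr_ge0.
  rewrite negb_and !negb_forall => /orP[|] /existsP[x]; rewrite negbK => hx.
    rewrite ler_wpDr// (bigD1 x)//= hx lerDl; apply: sumr_ge0 => g _; by case: ifP.
  rewrite ler_wpDl// (bigD1 x)//= hx lerDl; apply: sumr_ge0 => g _; by case: ifP.
(* The choices h = eps/4 for the upper tail and h = -eps/4 for the lower one minimise 2 h^2 - eps
   |h|, with minimum -eps^2/8. *)
have h2 : eps / 4 <= 2^-1 by lra.
have h2' : - (eps / 4) <= 2^-1 by lra.
apply: lerD.
  apply: (@le_trans _ _ (\sum_(g : {ffun V -> V})
     expR (- (eps ^+ 2 / 8 * p * #|G|%:R)))); last first.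
    by rewrite sumr_const card_ffun -[leLHS]mulr_natl.
  apply: ler_sum => g _; pose S := G :&: monochromatic g.
  apply: (@le_trans _ _ (\sum_(H : graph V |
     eps / 4 * (p * #|S|%:R + eps * p * #|G|%:R) <= eps / 4 * #|H :&: S|%:R) mu H)).
    rewrite big_mkcond [leRHS]big_mkcond; apply: ler_sum => H _.
    rewrite ler_pM2l ?divr_gt0//; rewrite /high -/S.
    case: ifP => [/ltW -> //|_]; case: ifP => // _; exact: pmf_ge0.
  apply: le_trans (percolation_chernoff _ _ h2) _; first exact: finset.subsetIl.
  rewrite ler_expR; have : p * #|S|%:R <= p * #|G|%:R.
    by rewrite ler_wpM2l// ler_nat subset_leq_card// finset.subsetIl.
  set a := p * _; move=> ab.
  have -> : - (eps ^+ 2 / 8 * p * #|G|%:R) = - (eps ^+ 2 / 8 * (p * #|G|%:R)) by ring.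
  rewrite -[eps * p * _]mulrA; move: ab; set b := p * _ => ab.
  have := ler_wpM2l (_ : 0 <= eps ^+ 2 / 8) ab.
  by move=> /(_ (divr_ge0 (sqr_ge0 _) (ler0n _ _))); lra.
apply: (@le_trans _ _ (\sum_(v : V) expR (- (eps ^+ 2 / 8 * p * deg%:R)))); last first.
  by rewrite sumr_const -[leLHS]mulr_natl.
apply: ler_sum => v _.
apply: (@le_trans _ _ (\sum_(H : graph V |
   - (eps / 4) * ((1 - eps) * p * deg%:R) <= - (eps / 4) * #|H :&: star v|%:R) mu H)).
  rewrite big_mkcond [leRHS]big_mkcond; apply: ler_sum => H _.
  rewrite ler_nM2l ?oppr_lt0 ?divr_gt0//; rewrite /low.
  case: ifP => [/ltW -> //|_]; case: ifP => // _; exact: pmf_ge0.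
apply: le_trans (percolation_chernoff _ _ h2') _.
  by apply/fintype.subsetP => e; rewrite inE => /andP[].
have -> : #|star v| = deg by rewrite -(degG v).
by rewrite ler_expR le_eqVlt; apply/orP; left; apply/eqP; field.
Qed.

End Percolation.

(** * Asymptotics *)

Section JohnsonEdges.
Variables n r s : nat.
Implicit Types (u v : johnson_vertex n r).

Lemma in_johnson_graph u v :
  ([set u; v]%SET \in johnson_graph n r s) = johnson_adj s u v.
Proof.
rewrite inE; apply/existsP/idP => [[a /existsP[b /andP[ab /eqP e]]]|uv]; last first.
  by exists u; apply/existsP; exists v; rewrite uv eqxx.
have abN : a != b by case/andP: ab.
have : a \in [set u; v]%SET by rewrite e !inE eqxx.
have : b \in [set u; v]%SET by rewrite e !inE eqxx orbT.
rewrite !inE => /orP[]/eqP bE /orP[]/eqP aE; subst; rewrite ?eqxx// in abN *.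
by rewrite johnson_adj_sym.
Qed.

Lemma johnson_graph_simple : simple_graph (johnson_graph n r s).
Proof.
move=> e; rewrite inE => /existsP[u /existsP[v /andP[/andP[uv _] /eqP->]]].
by rewrite cards2 uv.
Qed.

Hypothesis sr : (s < r)%N.

Lemma johnson_degree u :
  degree (johnson_graph n r s) u = ('C(n - r, r - s) * 'C(r, s))%N.
Proof.
rewrite (degreeE _ johnson_graph_simple) -(card_nbr sr u) -sum1_card [RHS]big_mkcond.
by apply: eq_bigr => v _; rewrite in_johnson_graph inE; case: johnson_adj.
Qed.

Variable R : realType.
Hypothesis rn : (r < n)%N.

Lemma johnson_expander (B : {set johnson_vertex n r}) :
  (2 * edges_in (johnson_graph n r s) B)%:R <=
  ('C(n - r, r - s) * 'C(r, s))%N%:R / #|{: johnson_vertex n r}|%:R * #|B|%:R ^+ 2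
  + ('C(n - r, r - s) * 'C(r, s))%N%:R * johnson_ratio n r s R * #|B|%:R.
Proof.
apply: le_trans (johnson_set_bound sr R rn B).
rewrite -(sum_adjacency_in _ johnson_graph_simple) natr_sum.
apply: ler_sum => u _; rewrite natr_sum; apply: ler_sum => v _.
by rewrite in_johnson_graph.
Qed.

End JohnsonEdges.

(** * Exponential bounds, eventual inequalities and a Borel-Cantelli criterion *)

Section ExponentialBounds.
Variable R : realType.

Lemma expR_ge_id (x : R) : x <= expR x.
Proof. by apply: le_trans (expR_ge1Dx x); rewrite lerDr. Qed.

(** As [L] bounds ln N, exp(-a) <= N^-k; the k powers absorb N^m and leave at least two. *)
Lemma expn_expRN_le (N k m : nat) (L a : R) : (0 < N)%N -> N%:R <= expR L ->
  (m + 2 <= k)%N -> k%:R * L <= a -> (N ^ m)%N%:R * expR (- a) <= (N%:R ^+ 2)^-1.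
Proof.
move=> N0 NL mk ka.
have NR0 : (0 : R) < N%:R by rewrite ltr0n.
have e1 : expR (- a) <= (N%:R ^+ k)^-1.
  apply: (@le_trans _ _ (expR (- (k%:R * L)))); first by rewrite ler_expR lerN2.
  rewrite expRN lef_pV2 ?posrE ?expR_gt0 ?exprn_gt0// expRM_natl.
  by rewrite lerXn2r// ?nnegrE ?expR_ge0.
apply: le_trans (ler_wpM2l _ e1) _; first exact: ler0n.
have -> : (N ^ m)%:R * (N%:R ^+ k)^-1 = (N%:R ^+ 2)^-1 * (N%:R ^+ (k - (m + 2)))^-1 :> R.
  rewrite natrX -{1}(subnKC mk) !exprD !invfM !mulrA divff ?mul1r//.
  by rewrite expf_neq0// gt_eqF.
rewrite ler_piMr ?invr_ge0 ?exprn_ge0//.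
by rewrite invf_le1 ?exprn_gt0// exprn_ege1// ler1n.
Qed.

End ExponentialBounds.

(** A quotient at least K > 0 rules out f n = 0, also by the convention 0 / 0 = 0; where g n = 0 the
    inequality is just f n >= 0. *)
Lemma much_greater_near (R : realType) (f g : nat -> R) (K : R) :
  (forall n, 0 <= f n) -> (forall n, 0 <= g n) -> 0 < K -> much_greater f g ->
  \forall n \near \oo, 0 < f n /\ K * g n <= f n.
Proof.
move=> f0 g0 K0 /cvgeyPge /(_ K); apply: filterS => n.
rewrite inver; have [gn|gn] := eqVneq (g n) 0.
  rewrite gn mulr0; have [->|fn] := eqVneq (f n) 0.
    by rewrite mul0e lee_fin leNgt K0.
  by rewrite f0 lt_neqAle eq_sym fn f0.
have gp : 0 < g n by rewrite lt_neqAle eq_sym gn g0.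
rewrite -EFinM lee_fin ler_pdivlMr// => Kf; split => //.
by apply: lt_le_trans Kf; rewrite mulr_gt0.
Qed.

(** The series converges by comparison with a telescoping one, 1/n^2 <= 2 (1/n - 1/(n + 1)). *)
Lemma borel_cantelli_inv_square (d : measure_display) (T : measurableType d)
    (R : realType) (P : probability T R) (F : (set T)^nat) (c : R) :
  (forall n, measurable (F n)) -> 0 <= c ->
  (\forall n \near \oo, P (F n) <= (c / n%:R ^+ 2)%:E)%E ->
  {ae P, forall w, \forall n \near \oo, ~ F n w}.
Proof.
move=> mF c0 [n0 _ PF].
(* Emptying the first events makes the bound hold at every positive index and removes the index 0,
   where the quotient by n^2 has no meaning. *)
pose F' n := if (n0.+1 <= n)%N then F n else set0.
have mF' n : measurable (F' n) by rewrite /F'; case: ifP.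
have PF' n : (0 < n)%N -> (P (F' n) <= (2 * c * (n%:R^-1 - n.+1%:R^-1))%:E)%E.
  move=> n1; have nR : (1 : R) <= n%:R by rewrite ler1n.
  have e : 0 <= (n%:R^-1 - n.+1%:R^-1 : R).
    by rewrite subr_ge0 lef_pV2 ?posrE ?ltr0n// ler_nat.
  rewrite /F'; case: ifP => h; last by rewrite measure0 lee_fin !mulr_ge0.
  apply: le_trans (PF n _) _; first exact: ltnW.
  rewrite lee_fin (mulrC 2) -mulrA ler_wpM2l//.
  rewrite -(natr1 n); have n0R : (0 : R) < n%:R by lra.
  have n1R : (0 : R) < n%:R + 1 by rewrite addr_gt0.
  have -> : n%:R^-1 - (n%:R + 1)^-1 = (n%:R * (n%:R + 1))^-1 :> R.
    by field; rewrite !gt_eqF.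
  rewrite -[leLHS]div1r ler_pdivrMr ?exprn_gt0//.
  rewrite mulrAC ler_pdivlMr ?mulr_gt0//; nra.
have S m : (\sum_(i < m) P (F' i) <= (2 * c * (1 - m%:R^-1))%:E)%E.
  elim: m => [|m IH]; first by rewrite big_ord0 invr0 subr0 lee_fin !mulr_ge0.
  rewrite big_ord_recr /=; case: m IH => [|m] IH.
    by rewrite big_ord0 add0e /F' /= measure0 invr1 subrr mulr0.
  apply: le_trans (leeD IH (PF' m.+1 _)) _ => //.
  by rewrite -EFinD lee_fin -mulrDr addrA subrK.
have fin : (\sum_(i <oo) P (F' i) < +oo)%E.
  apply: (@le_lt_trans _ _ (2 * c)%:E); last exact: ltry.
  apply: lime_le; first exact: is_cvg_nneseries.
  apply: nearW => m; rewrite big_mkord; apply: le_trans (S m) _.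
  by rewrite lee_fin ler_piMr ?mulr_ge0// gerBl invr_ge0.
have lim0 := lim_sup_set_cvg0 mF' fin.
exists (lim_sup_set F'); split => //.
  apply: bigcap_measurable => // k _; exact: bigcup_measurable.
move=> w /= nw k _; apply: contrapT => h; apply: nw.
exists (maxn k n0.+1) => // m /= km Fm; apply: h; exists m.
  by rewrite /= (leq_trans (leq_maxl _ _) km).
by rewrite /F' (leq_trans (leq_maxr _ _) km).
Qed.

(** * Choice of parameters and the almost sure bound *)

Section Asymptotics.
Context (R : realType) (d : measure_display)
    (T : measurableType d) (P : probability T R)
    (r s : nat -> nat) (p : nat -> R)
    (Gp : forall n : nat, T -> graph (johnson_vertex n (r n)))
    (n_gg_r : much_greater (fun n => n%:R : R) (fun n => (r n)%:R))
    (r_gg_s : much_greater (fun n => (r n)%:R : R) (fun n => (s n)%:R))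
    (p01 : forall n, 0 <= p n <= 1)
    (p_omega : much_greater p
       (fun n => 1 / Num.sqrt ('C(n - r n, r n - s n) * 'C(r n, s n))%N%:R))
    (Gp_perc : forall n,
       edge_percolation P (johnson_graph n (r n) (s n)) (p n) (Gp n)).

Let D n := ('C(n - r n, r n - s n) * 'C(r n, s n))%N.

Lemma eventually_parameters (eps K : R) : 0 < eps -> 0 < K -> \forall n \near \oo,
  [/\ (s n < r n)%N, (4 * r n <= n)%N, (2 * s n <= r n)%N, (0 < p n) &
   johnson_ratio n (r n) (s n) R <= eps /\ K / Num.sqrt (D n)%:R <= p n].
Proof.
move=> e0 K0.
(* The summand 4 yields 4 r <= n and 4 s <= r; the summand 4 / eps makes each term of
   [johnson_ratio] at most eps / 2. *)
have A0 : (0 : R) < 4 + 4 / eps by rewrite addr_gt0// divr_gt0.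
have H1 := much_greater_near _ _ A0 n_gg_r.
have H2 := much_greater_near _ _ A0 r_gg_s.
have H3 := much_greater_near _ _ K0 p_omega.
have {}H1 := H1 (fun=> ler0n _ _) (fun=> ler0n _ _).
have {}H2 := H2 (fun=> ler0n _ _) (fun=> ler0n _ _).
have {}H3 := H3 (fun n => proj1 (andP (p01 n))) (fun n => divr_ge0 ler01 (sqrtr_ge0 _)).
near=> n.
have [nR Arn] : 0 < (n%:R : R) /\ (4 + 4 / eps) * (r n)%:R <= n%:R by near: n.
have [rR Asr] : 0 < ((r n)%:R : R) /\ (4 + 4 / eps) * (s n)%:R <= (r n)%:R by near: n.
have [pR Kp] : 0 < p n /\ K * (1 / Num.sqrt (D n)%:R) <= p n by near: n.
have s0 : (0 : R) <= (s n)%:R by [].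
have q0 : (0 : R) < 4 / eps by rewrite divr_gt0.
have rn4 : 4 * (r n)%:R <= (n%:R : R) by nra.
have sr4 : 4 * (s n)%:R <= ((r n)%:R : R) by nra.
have scale_eps (x y : R) : 0 <= x -> (4 + 4 / eps) * x <= y -> 4 * x <= eps * y.
  move=> x0 h; have -> : 4 * x = eps * (4 / eps * x) by field; rewrite gt_eqF.
  by rewrite ler_pM2l//; lra.
have qrn := scale_eps _ _ (ler0n R (r n)) Arn.
have qsr := scale_eps _ _ (ler0n R (s n)) Asr.
have rn4' : (4 * r n <= n)%N by rewrite -(ler_nat R) natrM.
have sr4' : (4 * s n <= r n)%N by rewrite -(ler_nat R) natrM.
have r0 : (0 < r n)%N by rewrite -(ltr0n R).
have [sr sr2 rn] : [/\ (s n < r n)%N, (2 * s n <= r n)%N & (r n < n)%N].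
  by clear -rn4' sr4' r0; split; lia.
split; [exact: sr|exact: rn4'|exact: sr2|exact: pR|].
rewrite mulrA mulr1 in Kp; split; last exact: Kp.
rewrite /johnson_ratio.
have nr0 : (0 : R) < (n - r n)%:R by rewrite ltr0n subn_gt0.
have e1 : (s n)%:R / (r n)%:R <= eps / 2 by rewrite ler_pdivrMr//; lra.
have e2 : (r n - s n)%:R / (n - r n)%:R <= eps / 2 :> R.
  rewrite ler_pdivrMr// !natrB; [nra|exact: ltnW|exact: ltnW].
lra.
Unshelve. all: by end_near.
Qed.

Lemma ae_eventually_modularity_le (eps : R) : 0 < eps -> 2 * eps <= 1 ->
  {ae P, forall w, \forall n \near \oo, 0 <= modularity R (Gp n w) <= 10 * eps}.
Proof.
move=> e0 e2.
pose typ n := typical (johnson_graph n (r n) (s n)) (p n) eps (D n).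
(* 384 = 16 * 3 * 8: N <= exp (8 sqrt D), and the first term of
   probability_atypical needs eps^2 / 16 * p D >= 3 * (8 sqrt D). *)
have K0 : 0 < 384 / eps ^+ 2 by rewrite divr_gt0 ?exprn_gt0 ?ltr0n.
have par := eventually_parameters e0 K0.
have mT n : measurable [set w | Gp n w \notin typ n].
  rewrite (_ : [set _ | _] = [set w | Gp n w \in (~: typ n)%SET]).
    exact: (measurable_fin_event (measurable_percolation (Gp_perc n))).
  by apply/seteqP; split => w /=; rewrite finset.in_setC.
(* The constant 2 below counts the two terms of [probability_atypical], each at most N^-2 <=
   n^-2. *)
have ae1 : {ae P, forall w, \forall n \near \oo, ~ Gp n w \notin typ n}.
  apply: (@borel_cantelli_inv_square _ _ _ P (fun n => [set w | Gp n w \notin typ n]) 2) => //.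
  near=> n.
  have [sr rn4 sr2 pn [kap Kp]] : [/\ (s n < r n)%N, (4 * r n <= n)%N, (2 * s n <= r n)%N,
      (0 < p n) & johnson_ratio n (r n) (s n) R <= eps /\
        384 / eps ^+ 2 / Num.sqrt (D n)%:R <= p n] by near: n.
  have rn : (r n < n)%N by lia.
  apply: le_trans (probability_atypical (Gp_perc n) (p01 n) _ _) _.
  - by rewrite e0; lra.
  - exact: johnson_degree.
  rewrite lee_fin card_johnson_vertex.
  set N := 'C(n, r n).
  have nN : (n <= N)%N by apply: leq_bin_interior; lia.
  have n0 : (0 < n)%N by lia.
  have N0 : (0 < N)%N by lia.
  have D0 : (0 < D n)%N by rewrite muln_gt0 !bin_gt0; lia.
  pose q : R := Num.sqrt (D n)%:R.
  have q0 : 0 < q by rewrite sqrtr_gt0 ltr0n.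
  have qq : q ^+ 2 = (D n)%:R by rewrite sqr_sqrtr.
  (* N <= D^4 = q^8 <= exp(8 q), as q <= exp q. *)
  have NL : (N%:R : R) <= expR (8 * q).
    apply: (@le_trans _ _ ((D n ^ 4)%N%:R)).
      by rewrite ler_nat bin_leq_johnson_degree.
    rewrite natrX -qq -exprM -[(2 * 4)%N]/8%N expRM_natl lerXn2r ?nnegrE ?expR_ge0 ?(ltW q0)//.
    exact: expR_ge_id.
  have pD : 384 * q <= eps ^+ 2 * p n * (D n)%:R.
    move: Kp; rewrite -/q ler_pdivrMr// ler_pdivrMr ?exprn_gt0// => h.
    by rewrite -qq; have := ler_wpM2r (ltW q0) h; lra.
  have N2 : ((N%:R : R) ^+ 2)^-1 <= (n%:R ^+ 2)^-1.
    by rewrite lef_pV2 ?posrE ?exprn_gt0 ?ltr0n// lerXn2r ?nnegrE ?ler_nat.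
  have M2 : 2 * (#|johnson_graph n (r n) (s n)|%:R : R) = N%:R * (D n)%:R.
    rewrite -!natrM -(sum_degree (@johnson_graph_simple _ _ _)).
    rewrite (eq_bigr (fun=> D n)) ?sum_nat_const ?card_johnson_vertex// => v _.
    exact: johnson_degree.
  have -> : 2 / n%:R ^+ 2 = (n%:R ^+ 2)^-1 + (n%:R ^+ 2)^-1 :> R by lra.
  apply: lerD; apply: le_trans N2.
    (* N^N colourings need k >= N + 2, and k = 3 N suffices; the graph has N D / 2 edges, so the
       exponent is at least 24 q N = 3 N (8 q). *)
    apply: (@expn_expRN_le R N (N * 3) N (8 * q)); [exact: N0|exact: NL|lia|].
    have := ler_wpM2l (ler0n R N) pD; rewrite natrM.
    set M := #|_|%:R in M2 *; have -> : M = N%:R * (D n)%:R / 2 by lra.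
    lra.
  (* For the N stars the exponent is at least 384 q / 8 = 6 (8 q), and 6 >= 1 + 2. *)
  rewrite -{1}(expn1 N); apply: (@expn_expRN_le R N 6 1 (8 * q)); [exact: N0|exact: NL|by []|].
  lra.
apply: filterS ae1 => w typw.
near=> n.
have [sr rn4 sr2 pn [kap Kp]] : [/\ (s n < r n)%N, (4 * r n <= n)%N, (2 * s n <= r n)%N,
    (0 < p n) & johnson_ratio n (r n) (s n) R <= eps /\
      384 / eps ^+ 2 / Num.sqrt (D n)%:R <= p n] by near: n.
have rn : (r n < n)%N by lia.
have tw : Gp n w \in typ n by apply/negPn/negP; near: n.
have [subG _ _ _] := Gp_perc n.
apply: (@modularity_bounds R _ (johnson_graph n (r n) (s n)) (Gp n w) (D n) (p n) eps
   (johnson_ratio n (r n) (s n) R)) => //.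
- exact: johnson_graph_simple.
- by rewrite card_johnson_vertex bin_gt0 ltnW.
- by rewrite muln_gt0 !bin_gt0; lia.
- exact: johnson_degree.
- exact: johnson_expander.
- by rewrite addr_ge0 ?divr_ge0.
- move=> g; exact: typical_monochromatic tw.
- move=> v; exact: typical_degree tw.
Unshelve. all: by end_near.
Qed.

End Asymptotics.

Theorem theorem3p12 (R : realType) (d : measure_display)
    (T : measurableType d) (P : probability T R)
    (r s : nat -> nat) (p : nat -> R)
    (Gp : forall n : nat, T -> graph (johnson_vertex n (r n)))
    (n_gg_r : much_greater (fun n => n%:R : R) (fun n => (r n)%:R))
    (r_gg_s : much_greater (fun n => (r n)%:R : R) (fun n => (s n)%:R))
    (p01 : forall n, 0 <= p n <= 1)
    (p_omega : much_greater p
       (fun n => 1 / Num.sqrt ('C(n - r n, r n - s n) * 'C(r n, s n))%N%:R))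
    (Gp_perc : forall n,
       edge_percolation P (johnson_graph n (r n) (s n)) (p n) (Gp n)) :
  {ae P, forall w, (fun n => modularity R (Gp n w)) @ \oo --> (0 : R)}.
Proof.
(* The bound is used with eps = 1/(k + 2) for all k at once, a countable intersection of almost sure
   events; the shift by 2 ensures 2 eps <= 1. *)
have H : {ae P, forall w, forall k : nat, \forall n \near \oo,
    0 <= modularity R (Gp n w) <= 10 * k.+2%:R^-1}.
  apply/ae_foralln => k.
  apply: (ae_eventually_modularity_le n_gg_r r_gg_s p01 p_omega Gp_perc).
    by rewrite invr_gt0.
  by rewrite ler_pdivrMr// mul1r ler_nat.
apply: filterS H => w H; apply/cvgr0Pnorm_le => e e0.
pose k := Num.bound (10 / e).
have ke : 10 * k.+2%:R^-1 <= e.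
  rewrite ler_pdivrMr// mulrC -ler_pdivrMr//.
  apply: le_trans (ltW (archi_boundP _)) _; first by rewrite divr_ge0// ltW.
  rewrite ler_nat; exact: leq_trans (leqnSn _) (leqnSn _).
by apply: filterS (H k) => n /andP[m0 m1]; rewrite ger0_norm// (le_trans m1).
Qed.
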